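(* Let $w\in F$ be a positive word. If $r$ and $s$ are rational, then $R(w,r,s)$ is rational. Moreover, if $w$ is not a power of $a$ or of $b$, the denominator of $R(w,r,s)$ is no bigger than the minimum of the denominators of $r$ and of $s$ (all fractions in lowest terms).
   Context: $F$ is the free group on two generators $a,b$. A word in $F$ is positive if it contains only the letters $a$ and $b$, and no $a^{-1}$ or $b^{-1}$. $\mathrm{Homeo}^+(S^1)^\sim$ denotes the group of increasing homeomorphisms of $\mathbb{R}$ commuting with $x\mapsto x+1$ (lifts of orientation-preserving homeomorphisms of $S^1=\mathbb{R}/\mathbb{Z}$), and $\mathrm{rot}^\sim(\varphi)=\lim_{n\to\infty}(\varphi^n(x)-x)/n\in\mathbb{R}$ is the real-valued Poincaré rotation number. For $w\in F$ and $r,s\in\mathbb{R}$, $R(w,r,s)$ denotes the supremum of $\mathrm{rot}^\sim(\rho(w))$ over all homomorphisms $\rho:F\to \mathrm{Homeo}^+(S^1)^\sim$ with $\mathrm{rot}^\sim(\rho(a))=r$ and $\mathrm{rot}^\sim(\rho(b))=s$. *)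

(* Defs.v *)
From HB Require Import structures.
From mathcomp Require Import all_boot all_order all_algebra.
From mathcomp Require Import all_classical all_reals all_analysis.
From mathcomp Require Import lra zify.

Set Implicit Arguments.
Unset Strict Implicit.
Unset Printing Implicit Defensive.

Import Order.TTheory GRing.Theory Num.Theory.
Import numFieldNormedType.Exports.

Local Open Scope classical_set_scope.
Local Open Scope ring_scope.

(** * The free group on two generators *)

(* [(g, e)] is a generator ([g = false] for [a], [g = true] for [b]) with a
   sign ([e = true] for the generator itself, [e = false] for its inverse). *)
Definition letter : Type := (bool * bool)%type.

Definition letter_inv (l : letter) : letter := (l.1, ~~ l.2).

Definition reduced (u : seq letter) : bool :=
  sorted (fun x y => y != letter_inv x) u.

(* Left multiplication of a reduced word by a letter. *)
Definition lmul (x : letter) (u : seq letter) : seq letter :=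
  if u is y :: u' then if y == letter_inv x then u' else x :: u else [:: x].

Definition red_mul (u v : seq letter) : seq letter := foldr lmul v u.

Definition red_inv (u : seq letter) : seq letter := rev (map letter_inv u).

Lemma letter_invK : involutive letter_inv.
Proof. by case=> g e; rewrite /letter_inv /= negbK. Qed.

Lemma reduced_cons x u : reduced (x :: u) -> reduced u.
Proof. exact: path_sorted. Qed.

Lemma reduced_lmul x u : reduced u -> reduced (lmul x u).
Proof.
case: u => [//|y u] /= ru; case: ifPn => [_|yx]; last by rewrite /= yx.
exact: (reduced_cons ru).
Qed.

Lemma reduced_mul u v : reduced v -> reduced (red_mul u v).
Proof. by move=> rv; elim: u => //= x u; exact: reduced_lmul. Qed.

Lemma lmulK x u : reduced u ->
  lmul x (lmul (letter_inv x) u) = u.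
Proof.
case: u => [|y u] ru /=; first by rewrite eqxx.
rewrite letter_invK; case: eqP => [yx|_] /=; last by rewrite eqxx.
rewrite -{}yx {x}; case: u ru => [//|z u] /= /andP[/negbTE zy _].
by rewrite zy.
Qed.

Lemma red_mul_lmul x u v : reduced v ->
  red_mul (lmul x u) v = lmul x (red_mul u v).
Proof.
move=> rv; case: u => [//|y u] /=; case: eqP => [->|//].
by rewrite lmulK //; exact: reduced_mul.
Qed.

Lemma red_mulA u v t : reduced t ->
  red_mul u (red_mul v t) = red_mul (red_mul u v) t.
Proof. by move=> rt; elim: u => //= x u ->; rewrite red_mul_lmul. Qed.

Lemma red_mulu0 u : reduced u -> red_mul u [::] = u.
Proof.
elim: u => //= x u IH ru; rewrite (IH (reduced_cons ru)).
by case: u ru {IH} => //= y u /andP[/negbTE ->].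
Qed.

Lemma reduced_inv u : reduced u -> reduced (red_inv u).
Proof.
rewrite /reduced /red_inv rev_sorted sorted_map.
apply: sub_sorted => x y /= yx.
by apply: contra_neq yx => ->; rewrite letter_invK.
Qed.

Lemma red_mulVu u : reduced u -> red_mul (red_inv u) u = [::].
Proof.
elim: u => //= x u IH ru.
rewrite /red_inv /= rev_cons -cats1 /red_mul foldr_cat /= letter_invK eqxx.
exact: IH (reduced_cons ru).
Qed.

Record free2 := Free2 { free2_word :> seq letter ; _ : reduced free2_word }.

HB.instance Definition _ := [isSub for free2_word].
HB.instance Definition _ := [Choice of free2 by <:].

Definition free2_one : free2 := @Free2 [::] isT.
Definition free2_mul (u v : free2) : free2 := Free2 (reduced_mul u (valP v)).
Definition free2_inv (u : free2) : free2 := Free2 (reduced_inv (valP u)).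

Lemma free2_mulA : associative free2_mul.
Proof. by move=> u v t; apply: val_inj => /=; rewrite red_mulA //; exact: valP t. Qed.

Lemma free2_mul1g : left_id free2_one free2_mul.
Proof. by move=> u; exact: val_inj. Qed.

Lemma free2_mulg1 : right_id free2_one free2_mul.
Proof. by move=> u; apply: val_inj => /=; rewrite red_mulu0 //; exact: valP u. Qed.

Lemma free2_mulVg : left_inverse free2_one free2_inv free2_mul.
Proof. by move=> u; apply: val_inj => /=; rewrite red_mulVu //; exact: valP u. Qed.

Lemma free2_invK : involutive free2_inv.
Proof.
move=> u; apply: val_inj => /=; rewrite /red_inv map_rev revK -map_comp.
by rewrite -[RHS]map_id; apply: eq_map => x /=; rewrite letter_invK.
Qed.

Lemma free2_mulgV : right_inverse free2_one free2_inv free2_mul.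
Proof. by move=> u; rewrite -{1}[u]free2_invK free2_mulVg. Qed.

HB.instance Definition _ := isGroup.Build free2
  free2_mulA free2_mul1g free2_mulg1 free2_mulVg free2_mulgV.

Definition gen_a : free2 := @Free2 [:: (false, true)] isT.
Definition gen_b : free2 := @Free2 [:: (true, true)] isT.

Definition positive_word (w : free2) : bool := all (fun l : letter => l.2) w.

Definition is_power_of (x w : free2) : Prop :=
  exists n : nat, w = (x ^+ n)%g \/ w = (x ^- n)%g.

(** * Lifts of orientation-preserving homeomorphisms of the circle *)

Record circle_lift (R : realType) := CircleLift {
  lift_fun :> R -> R ;
  lift_inv : R -> R ;
  lift_funK : cancel lift_fun lift_inv ;
  lift_invK : cancel lift_inv lift_fun ;
  lift_continuous : continuous lift_fun ;
  lift_inv_continuous : continuous lift_inv ;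
  lift_increasing : {homo lift_fun : x y / x < y} ;
  lift_periodic : forall x, lift_fun (x + 1) = lift_fun x + 1 }.

Section CircleLiftGroup.
Variable R : realType.
Implicit Types f g h : circle_lift R.

Lemma circle_liftP f g : f =1 g -> f = g.
Proof.
case: f g => [f f' fK f'K cf cf' mf pf] [g g' gK g'K cg cg' mg pg] /= fg.
have {}fg : f = g by exact/funext.
have f'g' : f' = g' by apply/funext => x; rewrite -{1}[x]g'K -fg fK.
by subst g g'; congr CircleLift; exact: Prop_irrelevance.
Qed.

HB.instance Definition _ := gen_eqMixin (circle_lift R).
HB.instance Definition _ := gen_choiceMixin (circle_lift R).

Lemma lift_mono f : {mono f : x y / x < y}.
Proof. by apply: leW_mono; apply: le_mono; exact: lift_increasing. Qed.

Definition lift_one : circle_lift R.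
Proof.
by refine (@CircleLift R id id _ _ _ _ _ _) => //; move=> x; exact: cvg_id.
Defined.

Definition lift_mul f g : circle_lift R.
Proof.
refine (@CircleLift R (f \o g) (lift_inv g \o lift_inv f) _ _ _ _ _ _).
- exact: can_comp (@lift_funK _ f) (@lift_funK _ g).
- exact: can_comp (@lift_invK _ g) (@lift_invK _ f).
- by move=> x; apply: continuous_comp; exact: lift_continuous.
- by move=> x; apply: continuous_comp; exact: lift_inv_continuous.
- by move=> x y xy /=; do 2 apply: lift_increasing.
- by move=> x /=; rewrite !lift_periodic.
Defined.

Definition lift_inverse f : circle_lift R.
Proof.
refine (@CircleLift R (lift_inv f) f _ _ _ _ _ _).
- exact: lift_invK.
- exact: lift_funK.
- exact: lift_inv_continuous.
- exact: lift_continuous.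
- by move=> x y xy; rewrite -(lift_mono f) !lift_invK.
- by move=> x; apply: (can_inj (@lift_funK _ f)); rewrite lift_periodic !lift_invK.
Defined.

Lemma lift_mulA : associative lift_mul.
Proof. by move=> f g h; exact: circle_liftP. Qed.
Lemma lift_mul1g : left_id lift_one lift_mul.
Proof. by move=> f; exact: circle_liftP. Qed.
Lemma lift_mulg1 : right_id lift_one lift_mul.
Proof. by move=> f; exact: circle_liftP. Qed.
Lemma lift_mulVg : left_inverse lift_one lift_inverse lift_mul.
Proof. by move=> f; apply: circle_liftP => x /=; exact: lift_funK. Qed.
Lemma lift_mulgV : right_inverse lift_one lift_inverse lift_mul.
Proof. by move=> f; apply: circle_liftP => x /=; exact: lift_invK. Qed.

HB.instance Definition _ := isGroup.Build (circle_lift R)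
  lift_mulA lift_mul1g lift_mulg1 lift_mulVg lift_mulgV.

End CircleLiftGroup.

(** * Rotation numbers *)

(* The base point is [0]; by [rot_cvg] below the limit exists and every base
   point gives the same value. *)
Definition rot_num (R : realType) (phi : circle_lift R) : R :=
  limn (fun n : nat => (iter n phi 0 - 0) / n%:R).

Section RotCvg.
Variables (R : realType) (f : circle_lift R).

Lemma lift_addz x (m : int) : f (x + m%:~R) = f x + m%:~R.
Proof.
have addn (n : nat) y : f (y + n%:R) = f y + n%:R.
  elim: n y => [|n IH] y; first by rewrite !addr0.
  by rewrite -natr1 !addrA lift_periodic IH.
case: m => n; first by rewrite addn.
by rewrite NegzE mulrNz -[in RHS](subrK n.+1%:R x) addn addrK.
Qed.

Lemma iter_addz n x (m : int) : iter n f (x + m%:~R) = iter n f x + m%:~R.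
Proof. by elim: n => //= n ->; rewrite lift_addz. Qed.

Lemma iter_le n x y : x <= y -> iter n f x <= iter n f y.
Proof.
move=> xy; elim: n => //= n IH.
by move: IH; rewrite le_eqVlt => /orP[/eqP ->//|/lift_increasing/ltW].
Qed.

Lemma iter_displacement n x y :
  `|(iter n f x - x) - (iter n f y - y)| <= 1.
Proof.
have := floor_itv (x - y).
set m := Num.floor _ => /andP[m1 m2].
have lo : iter n f (y + m%:~R) <= iter n f x by apply: iter_le; lra.
have hi : iter n f x <= iter n f (y + (m + 1)%:~R).
  by apply: iter_le; lra.
move: lo hi m1 m2; rewrite !iter_addz intrD ler_norml => *; lra.
Qed.

Lemma iter_mul_bound m n :
  `|iter (m * n) f 0 - m%:R * iter n f 0| <= m%:R.
Proof.
elim: m => [|m IH]; first by rewrite mul0n mul0r subrr normr0.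
rewrite mulSn iterD -natr1 mulrDl mul1r.
have := iter_displacement n (iter (m * n) f 0) 0.
by move: IH; rewrite !ler_norml => /andP[? ?] /andP[? ?]; apply/andP; split; lra.
Qed.

Lemma rot_cauchy_bound m n :
  `|iter m.+1 f 0 / m.+1%:R - iter n.+1 f 0 / n.+1%:R|
    <= m.+1%:R^-1 + n.+1%:R^-1.
Proof.
have A := iter_mul_bound m.+1 n.+1.
have B := iter_mul_bound n.+1 m.+1.
rewrite mulnC in B.
have m0 : 0 < m.+1%:R :> R by [].
have n0 : 0 < n.+1%:R :> R by [].
have mn0 : 0 < m.+1%:R * n.+1%:R :> R by rewrite mulr_gt0.
rewrite -(ler_pM2l mn0) -{1}(gtr0_norm mn0) -normrM.
have -> : m.+1%:R * n.+1%:R *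
    (iter m.+1 f 0 / m.+1%:R - iter n.+1 f 0 / n.+1%:R) =
    n.+1%:R * iter m.+1 f 0 - m.+1%:R * iter n.+1 f 0 :> R.
  rewrite mulrBr; congr (_ - _).
    by rewrite mulrC -mulrA mulKf ?gt_eqF // mulrC.
  by rewrite mulrC -mulrA [m.+1%:R * _]mulrC mulKf ?gt_eqF // mulrC.
rewrite mulrDr mulrAC mulfV ?gt_eqF // mul1r mulfK ?gt_eqF //.
move: A B; rewrite !ler_norml => /andP[? ?] /andP[? ?]; apply/andP; split; lra.
Qed.

Lemma rot_cvg x :
  (fun n : nat => (iter n f x - x) / n%:R) @ \oo --> rot_num f.
Proof.
have cv0 : cvgn (fun n : nat => (iter n f 0 - 0) / n%:R).
  apply/cvg_ex.
  suff /cvg_ex[l ul] :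
      cvgn [sequence (iter n.+1 f 0 - 0) / n.+1%:R]_n.
    by exists l; rewrite -cvg_shiftS.
  apply/cauchy_cvgP/cauchy_exP => e e0.
  have e20 : 0 < e / 2 by rewrite divr_gt0.
  have [N _ HN] : \forall n \near \oo, @harmonic R n < e / 2.
    have /cvgrPdist_lt/(_ _ e20) := @cvg_harmonic R.
    by apply: filterS => n; rewrite sub0r normrN gtr0_norm // harmonic_gt0.
  exists ((iter N.+1 f 0 - 0) / N.+1%:R); exists N => // n Nn.
  rewrite /ball /= !subr0.
  apply: le_lt_trans (rot_cauchy_bound N n) _.
  by rewrite (splitr e) ltrD //; [exact: HN (leqnn N)|exact: HN Nn].
have d0 : (fun n : nat => ((iter n f x - x) - (iter n f 0 - 0)) / n%:R) @ \oo
    --> (0 : R).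
  rewrite -cvg_shiftS; apply/cvgrPdist_le => e e0.
  have /cvgrPdist_le/(_ _ e0) := @cvg_harmonic R.
  apply: filterS => n; rewrite !sub0r !normrN => he.
  apply: le_trans he; rewrite [harmonic n]/= normrM.
  rewrite -[leRHS]mul1r ler_wpM2r //; exact: (iter_displacement n.+1 x 0).
rewrite (_ : (fun n => _) = (fun n : nat => (iter n f 0 - 0) / n%:R) \+
    (fun n : nat => ((iter n f x - x) - (iter n f 0 - 0)) / n%:R)); last first.
  by apply/funext => n /=; rewrite -mulrDl addrCA subrr addr0.
by rewrite -[rot_num f]addr0; apply: cvgD => //; exact: cv0.
Qed.

End RotCvg.

Local Open Scope ereal_scope.

(* The supremum is taken in the extended reals, so that finiteness is not
   built into the definition by a conventional value. *)
Definition rot_sup (R : realType) (w : free2) (r s : R) : \bar R :=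
  ereal_sup [set (rot_num (rho w))%:E |
    rho in [set rho : {multiplicative free2 -> circle_lift R} |
            rot_num (rho gen_a) = r /\ rot_num (rho gen_b) = s]].

(* Main.v *)
Require Import Defs.
From HB Require Import structures.
From mathcomp Require Import all_boot all_order all_algebra.
From mathcomp Require Import all_classical all_reals all_analysis.
From mathcomp Require Import ring lra zify.

Import Order.TTheory GRing.Theory Num.Theory.
Import numFieldNormedType.Exports.

Set Implicit Arguments.
Unset Strict Implicit.
Unset Printing Implicit Defensive.

Local Open Scope ring_scope.

(** A lift [f] with rotation number p/q in lowest terms has a periodic orbit,
    which, enumerated increasingly as [alpha : int -> R], satisfies
    [alpha (i + q) = alpha i + 1] and [f (alpha i) = alpha (i + p)]. Hence [f]
    lies below the left-continuous jump map sending (alpha (i - 1), alpha i] to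
    [alpha (i + p)]. Replacing both generators of a positive word by their jump
    maps can only increase it, and makes it take values in the orbit of its
    leading letter (the one that acts last), which has q points modulo 1; so it
    has a periodic point of some period k <= q, and the word has rotation number
    at most some m/k. Since the jump maps are left-continuous, homeomorphisms
    with the same two orbits that approximate them closely enough still realise
    m/k. The supremum is therefore a maximum over boundedly many denominators.
    Finally, cyclic rotation of the word, which does not change the supremum,
    makes either letter the leading one. *)

(** * Rotation number estimates, and periodic points at rational rotation numbers *)

Section RotationEstimates.
Local Open Scope classical_set_scope.
Variables (R : realType).
Implicit Types (f g : circle_lift R) (x y c : R).

(** Sampling the limit along multiples of [n] lets bounds on every [n]-th iterate control
    [rot_num f]. *)
Lemma rot_sample f x (n : nat) (e : R) : (0 < n)%N -> 0 < e ->
  exists k : nat, (0 < k)%N /\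
    `|rot_num f - (iter (k * n) f x - x) / (k * n)%:R| < e.
Proof.
move=> n0 e0; have /cvgrPdist_lt/(_ _ e0)[M _ HM] := @rot_cvg _ f x.
exists M.+1; split=> //; apply: HM => /=.
by rewrite (leq_trans (leqnSn M)) // leq_pmulr.
Qed.

Lemma rot_ge f x c (n : nat) : (0 < n)%N ->
  (forall k : nat, x + k%:R * c <= iter (k * n) f x) -> c / n%:R <= rot_num f.
Proof.
move=> n0 H; rewrite leNgt; apply/negP => lt_rot.
have [|k [k0]] := @rot_sample f x n (c / n%:R - rot_num f) n0; first lra.
have : c / n%:R <= (iter (k * n) f x - x) / (k * n)%:R.
  rewrite ler_pdivlMr ?ltr0n ?muln_gt0 ?k0 // natrM mulrCA divfK ?pnatr_eq0 -?lt0n //.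
  by have := H k; lra.
by move=> ?; rewrite ltr_norml => /andP[? ?]; lra.
Qed.

Lemma rot_le f x c (n : nat) : (0 < n)%N ->
  (forall k : nat, iter (k * n) f x <= x + k%:R * c) -> rot_num f <= c / n%:R.
Proof.
move=> n0 H; rewrite leNgt; apply/negP => lt_rot.
have [|k [k0]] := @rot_sample f x n (rot_num f - c / n%:R) n0; first lra.
have : (iter (k * n) f x - x) / (k * n)%:R <= c / n%:R.
  rewrite ler_pdivrMr ?ltr0n ?muln_gt0 ?k0 // natrM mulrCA divfK ?pnatr_eq0 -?lt0n //.
  by have := H k; lra.
by move=> ?; rewrite ltr_norml => /andP[? ?]; lra.
Qed.

(** Translation by a real [c] need not commute with [f], so iterating the bound uses it at every
    [x]. Integer translations do commute, hence the single point in [rot_ge_period]. *)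
Lemma rot_ge_unif f c (n : nat) : (0 < n)%N ->
  (forall x, x + c <= iter n f x) -> c / n%:R <= rot_num f.
Proof.
move=> n0 H; apply: (@rot_ge f 0) => //; elim=> [|k IH]; first by rewrite mul0n mul0r addr0.
by rewrite mulSn iterD; apply: le_trans (H _); rewrite -natr1; lra.
Qed.

Lemma rot_le_unif f c (n : nat) : (0 < n)%N ->
  (forall x, iter n f x <= x + c) -> rot_num f <= c / n%:R.
Proof.
move=> n0 H; apply: (@rot_le f 0) => //; elim=> [|k IH]; first by rewrite mul0n mul0r addr0.
by rewrite mulSn iterD; apply: le_trans (H _) _; rewrite -natr1; lra.
Qed.

Lemma rot_ge_period f x (m : int) (n : nat) : (0 < n)%N ->
  x + m%:~R <= iter n f x -> m%:~R / n%:R <= rot_num f.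
Proof.
move=> n0 H; apply: (@rot_ge f x) => //; elim=> [|k IH]; first by rewrite mul0n mul0r addr0.
rewrite mulnC mulnS mulnC addnC iterD.
have e : k%:R * m%:~R = (k%:Z * m)%:~R :> R by rewrite intrM.
have := @iter_le _ f (k * n) _ _ H; rewrite iter_addz; move: IH; rewrite -natr1; lra.
Qed.

Lemma rot_le_period f x (m : int) (n : nat) : (0 < n)%N ->
  iter n f x <= x + m%:~R -> rot_num f <= m%:~R / n%:R.
Proof.
move=> n0 H; apply: (@rot_le f x) => //; elim=> [|k IH]; first by rewrite mul0n mul0r addr0.
rewrite mulnC mulnS mulnC addnC iterD.
have := @iter_le _ f (k * n) _ _ H; rewrite iter_addz; move: IH; rewrite -natr1; lra.
Qed.

Lemma rot_period f x (m : int) (n : nat) : (0 < n)%N ->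
  iter n f x = x + m%:~R -> rot_num f = m%:~R / n%:R.
Proof.
move=> n0 H; apply/eqP; rewrite eq_le.
by rewrite (@rot_ge_period f x) ?(@rot_le_period f x) ?H.
Qed.

(** The displacement of [h] varies by at most 1, so the two orbit averages differ by at most
    [1 / n]. *)
Lemma rot_conj f g (h : circle_lift R) :
  (forall x, h (f x) = g (h x)) -> rot_num f = rot_num g.
Proof.
Proof.
move=> hfg; have itE n : iter n g (h 0) = h (iter n f 0).
  by elim: n => //= n ->; rewrite hfg.
have d0 : (fun n : nat => (iter n g (h 0) - h 0) / n%:R -
    (iter n f 0 - 0) / n%:R) @ \oo --> (0 : R).
  rewrite -cvg_shiftS; apply/cvgrPdist_le => e e0.
  have /cvgrPdist_le/(_ _ e0) := @cvg_harmonic R.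
  apply: filterS => n; rewrite !sub0r !normrN => he.
  apply: le_trans he; rewrite /= itE -hfg -mulrBl normrM.
  rewrite -[leRHS]mul1r ler_wpM2r ?normr_ge0 //.
  have := @iter_displacement _ h 1 (iter n.+1 f 0) 0.
  by rewrite /= !ler_norml => /andP[? ?]; apply/andP; split; lra.
have : (0 : R) = rot_num g - rot_num f.
  apply: cvg_unique d0 _; first exact: norm_hausdorff.
  exact: cvgB (@rot_cvg _ g (h 0)) (@rot_cvg _ f 0).
by move=> ?; lra.
Qed.

(** Otherwise the continuous 1-periodic function [F] keeps one sign; its extrema on [0, 1] then
    bound it away from 0, which pushes [rot_num f] off [p / n]. *)
Lemma rational_rot_fixpoint f (p : int) (n : nat) : (0 < n)%N ->
  rot_num f = p%:~R / n%:R -> exists x, iter n f x = x + p%:~R.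
Proof.
Proof.
move=> n0 rotf; apply: contrapT => /forallNP nofix.
pose F x := iter n f x - x - p%:~R.
have cF : continuous F.
  have cit k : continuous (iter k f).
    elim: k => [|k IH] x; first exact: cvg_id.
    by apply: (@continuous_comp _ _ _ (iter k f) f); [exact: IH|exact: lift_continuous].
  move=> x; apply: cvgB; last exact: cvg_cst.
  by apply: cvgB; [exact: cit|exact: cvg_id].
have cFw a b : {within `[a, b], continuous F}%classic by exact: continuous_subspaceT.
have Fper x (m : int) : F (x + m%:~R) = F x by rewrite /F iter_addz; lra.
have Fn0 x : F x != 0.
  by apply/eqP => Fx; apply: (nofix x); move: Fx; rewrite /F; lra.
have Fred x : exists2 y, y \in `[0, 1]%R & F x = F y.
  exists (x - (Num.floor x)%:~R); last by rewrite -mulrNz Fper.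
  by have /andP[] := floor_itv x; rewrite in_itv /= intrD => *; apply/andP; split; lra.
have [a a01 Fa] := EVT_min ler01 (cFw 0 1).
have [b b01 Fb] := EVT_max ler01 (cFw 0 1).
have nR : 0 < n%:R :> R by rewrite ltr0n.
have [a_pos|a_neg] := ltP 0 (F a).
  have : (p%:~R + F a) / n%:R <= rot_num f.
    apply: rot_ge_unif => // x; have [y y01 Fxy] := Fred x.
    by have := Fa _ y01; rewrite -Fxy /F; lra.
  by rewrite rotf ler_pM2r ?invr_gt0 //; lra.
have [b_neg|b_pos] := ltP (F b) 0.
  have : rot_num f <= (p%:~R + F b) / n%:R.
    apply: rot_le_unif => // x; have [y y01 Fxy] := Fred x.
    by have := Fb _ y01; rewrite -Fxy /F; lra.
  by rewrite rotf ler_pM2r ?invr_gt0 //; lra.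
have [ab|ba] := leP a b.
  have [|c _ /eqP] := @IVT _ F a b 0 ab (cFw a b); last by rewrite (negbTE (Fn0 c)).
  by rewrite ge_min le_max a_neg b_pos orbT.
have [|c _ /eqP] := @IVT _ F b a 0 (ltW ba) (cFw b a); last by rewrite (negbTE (Fn0 c)).
by rewrite ge_min le_max a_neg b_pos orbT.
Qed.

End RotationEstimates.

(** * Periodic orbits as increasing grids, and their jump maps *)

Section Grids.
Variable R : realType.
Implicit Types (f : circle_lift R) (alpha : int -> R) (x y : R) (i j m p : int).

(** The lift of an [n]-point subset of the circle. Indexing by all of [int] turns the action of a
    lift on its periodic orbit into a translation of indices. *)
Definition grid alpha (n : nat) : Prop :=
  [/\ (0 < n)%N, {homo alpha : i j / i < j} &
      forall i, alpha (i + n%:Z) = alpha i + 1].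

(** The default 0 is never reached on a grid, by [grid_ceilP]. Cells are closed on the right, so a
    grid point is its own ceiling. *)
Definition grid_ceil alpha x : int :=
  xget 0 [set i | alpha (i - 1) < x <= alpha i]%classic.

(* The largest value at [x] of a lift sending [alpha i] to [alpha (i + p)], up
   to an arbitrarily small error; it is left-continuous. *)
Definition grid_jump alpha p x : R := alpha (grid_ceil alpha x + p).

Section OneGrid.
Variables (alpha : int -> R) (n : nat).
Hypothesis alphaP : grid alpha n.

Lemma grid_le : {mono alpha : i j / i <= j}.
Proof. by have [_ inc _] := alphaP; exact: le_mono. Qed.

Lemma grid_lt : {mono alpha : i j / i < j}.
Proof. exact: leW_mono grid_le. Qed.

Lemma grid_shift i m : alpha (i + m * n%:Z) = alpha i + m%:~R.
Proof.
have [_ _ per] := alphaP.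
have pos (k : nat) j : alpha (j + k%:Z * n%:Z) = alpha j + k%:R.
  elim: k j => [|k IH] j; first by rewrite mul0r !addr0.
  by rewrite intS mulrDl mul1r addrA IH per -addrA -natr1 [1 + _]addrC.
case: m => k; first exact: pos.
by rewrite NegzE mulrNz -(addrK k.+1%:R (alpha (_ + _))) -pos mulNr subrK.
Qed.

Lemma grid_ceilP x :
  alpha (grid_ceil alpha x - 1) < x <= alpha (grid_ceil alpha x).
Proof.
rewrite /grid_ceil; case: xgetP => [i _ //|none]; exfalso.
have [n0 _ _] := alphaP.
(* The extra [- 1] puts [alpha (N * n%:Z)] strictly below [x], so the least [k] found below is a
   successor. *)
pose N : int := Num.floor (x - alpha 0) - 1.
have loN : alpha (N * n%:Z) < x.
  rewrite -[_ * _]add0r grid_shift /N intrB.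
  by have /andP[? _] := floor_itv (x - alpha 0); lra.
have exk : exists k : nat, x <= alpha (N * n%:Z + k%:Z).
  exists (2 * n)%N; rewrite PoszM -mulrDl -[_ * _]add0r grid_shift /N.
  have /andP[_] := floor_itv (x - alpha 0).
  by rewrite !intrD => ?; rewrite mulrNz; lra.
case: (ex_minnP exk) => -[|k] xk kmin.
  by move: loN; rewrite ltNge -[N * _]addr0 xk.
apply: (none (N * n%:Z + k.+1%:Z)).
rewrite /= xk andbT ltNge; apply/negP => xk'.
suff : (k < k)%N by rewrite ltnn.
by apply: kmin; move: xk'; rewrite (_ : _ - 1 = N * n%:Z + k%:Z) //; lia.
Qed.

Lemma grid_ceil_lt x : alpha (grid_ceil alpha x - 1) < x.
Proof. by have /andP[] := grid_ceilP x. Qed.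

Lemma grid_ceil_ge x : x <= alpha (grid_ceil alpha x).
Proof. by have /andP[] := grid_ceilP x. Qed.

Lemma grid_ceil_eq x i : alpha (i - 1) < x -> x <= alpha i -> grid_ceil alpha x = i.
Proof.
move=> lo hi; have := lt_le_trans lo (grid_ceil_ge x).
have := lt_le_trans (grid_ceil_lt x) hi; rewrite !grid_lt; lia.
Qed.

Lemma grid_ceil_le x i : x <= alpha i -> grid_ceil alpha x <= i.
Proof. by move=> /(lt_le_trans (grid_ceil_lt x)); rewrite grid_lt; lia. Qed.

Lemma grid_ceil_mono x y : x <= y -> grid_ceil alpha x <= grid_ceil alpha y.
Proof. by move=> xy; apply: grid_ceil_le; apply: le_trans xy (grid_ceil_ge y). Qed.

Lemma grid_ceil_grid i : grid_ceil alpha (alpha i) = i.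
Proof. by apply: grid_ceil_eq => //; rewrite grid_lt; lia. Qed.

Lemma grid_ceilD x m : grid_ceil alpha (x + m%:~R) = grid_ceil alpha x + m * n%:Z.
Proof.
apply: grid_ceil_eq; last by rewrite grid_shift lerD2r grid_ceil_ge.
by rewrite addrAC grid_shift ltrD2r grid_ceil_lt.
Qed.

Lemma grid_jump_mono p x y : x <= y -> grid_jump alpha p x <= grid_jump alpha p y.
Proof. by move=> /grid_ceil_mono; rewrite grid_le lerD2r. Qed.

Lemma le_grid_jump f p x : (forall i, f (alpha i) = alpha (i + p)) ->
  f x <= grid_jump alpha p x.
Proof.
move=> fa; rewrite /grid_jump -fa -[_ <= _]/(iter 1 f _ <= iter 1 f _).
exact/iter_le/grid_ceil_ge.
Qed.

(** From the left end of its cell, [x] moves [p + 1] indices, which is at most [|p| + 1] periods of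
    [n] indices. *)
Lemma grid_jump_bound p x : grid_jump alpha p x <= x + (`|p| + 1)%:~R.
Proof.
have [n0 _ _] := alphaP.
apply: (@le_trans _ _ (alpha (grid_ceil alpha x - 1) + (`|p| + 1)%:~R)).
  rewrite -grid_shift grid_le; nia.
by rewrite lerD2r ltW // grid_ceil_lt.
Qed.

Lemma grid_rot f p : (forall i, f (alpha i) = alpha (i + p)) ->
  rot_num f = p%:~R / n%:R.
Proof.
move=> fa; have [n0 _ _] := alphaP.
apply: (@rot_period _ f (alpha 0)) => //; rewrite -grid_shift.
have it k i : iter k f (alpha i) = alpha (i + k%:Z * p).
  elim: k => [|k IH] /=; first by rewrite mul0r addr0.
  by rewrite IH fa; congr (alpha _); lia.
by rewrite it mulrC.
Qed.

End OneGrid.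

(** No sorting of the orbit is required: if [u * p + v * n = 1], then [f^u + v] is the successor map
    on the orbit of a periodic point, and iterating it enumerates the orbit in increasing order. *)
Lemma rational_rot_grid f p (n : nat) : (0 < n)%N -> coprimez p n%:Z ->
  rot_num f = p%:~R / n%:R ->
  exists alpha, grid alpha n /\ forall i, f (alpha i) = alpha (i + p).
Proof.
move=> n0 cop rotf; have [x0 fx0] := rational_rot_fixpoint n0 rotf.
have nz : n%:Z != 0 by rewrite eqz_nat -lt0n.
(* The Bezout coefficient of [p] is reduced modulo [n] to be nonnegative, so that it can count
   iterations. *)
have [u [v uv]] : exists u : nat, exists v : int, u%:Z * p + v * n%:Z = 1.
  have [u0 [v0 uv0]] := Bezoutz p n%:Z.
  have : u0 * p + v0 * n%:Z = 1 by rewrite uv0; apply/eqP; exact: cop.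
  exists `|(u0 %% n%:Z)%Z|%N, (v0 + (u0 %/ n%:Z)%Z * p).
  rewrite gez0_abs ?modz_ge0 //.
  have := divz_eq u0 n%:Z; nia.
have itf (k j : nat) : iter (j + k * n) f x0 = iter j f x0 + (k%:Z * p)%:~R.
  elim: k => [|k IH]; first by rewrite addn0 mul0r addr0.
  rewrite mulSn addnCA addnC iterD fx0 iter_addz IH intS mulrDl mul1r intrD; lra.
(* The orbit of [x0] is extended to negative times through [f^n x0 = x0 + p]. *)
have [orb [orbS orbD]] : exists orb : int -> R,
    (forall k (l : nat), orb (k + l%:Z) = iter l f (orb k)) /\
    (forall k m, orb (k + m * n%:Z) = orb k + (m * p)%:~R).
  pose orb (k : int) : R :=
    iter `|(k %% n%:Z)%Z|%N f x0 + ((k %/ n%:Z)%Z * p)%:~R.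
  have orbE (j : nat) m : orb (j%:Z + m * n%:Z) = iter j f x0 + (m * p)%:~R.
    rewrite /orb [_ + m * _]addrC divzMDl // modzMDl divz_nat modz_nat /=.
    by rewrite [in RHS](divn_eq j n) addnC itf -addrA -intrD; congr (_ + _%:~R); lia.
  have orb_rep k : exists (j : nat) m, k = j%:Z + m * n%:Z.
    exists `|(k %% n%:Z)%Z|%N, (k %/ n%:Z)%Z.
    by rewrite gez0_abs ?modz_ge0 // addrC -divz_eq.
  exists orb; split=> k.
    move=> l; have [j [m ->]] := orb_rep k.
    by rewrite addrAC -PoszD !orbE addnC iterD iter_addz.
  move=> m; have [j [m' ->]] := orb_rep k.
  by rewrite -addrA -mulrDl !orbE -addrA -intrD -mulrDl.
pose alpha i := orb (i * u%:Z) + (i * v)%:~R.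
have per i : alpha (i + n%:Z) = alpha i + 1.
  rewrite /alpha mulrDl [n%:Z * _]mulrC orbD -!addrA -[1]/(1%:~R) -!intrD.
  by congr (_ + _%:~R); rewrite -uv; lia.
exists alpha; split; last first.
  move=> i; rewrite /alpha lift_addz -[f _]/(iter 1 f _) -orbS.
  have -> : (i + p) * u%:Z = i * u%:Z + 1 + (- v) * n%:Z by rewrite -uv; ring.
  by rewrite orbD -addrA -intrD; congr (_ + _%:~R); ring.
pose H x := iter u f x + v%:~R.
have alphaS i : alpha (i + 1) = H (alpha i).
  rewrite /H /alpha iter_addz -orbS mulrDl mul1r mulrDl mul1r intrD; lra.
have Hle x y : x <= y -> H x <= H y by move=> xy; rewrite lerD2r iter_le.
have alpha_lt i : alpha i < alpha (i + 1).
  (* One failure to increase would propagate through the monotone map [H], contradicting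
     [alpha (i + n) = alpha i + 1]. *)
  rewrite ltNge alphaS; apply/negP => Hi.
  have : forall k : nat, alpha (i + k%:Z) <= alpha i.
    elim=> [|k IH]; first by rewrite addr0.
    rewrite intS [1 + _]addrC addrA alphaS.
    exact: le_trans (Hle _ _ IH) Hi.
  by move=> /(_ n); rewrite per; lra.
split=> // i j ij.
have [k ->] : exists k : nat, j = i + k.+1%:Z by exists `|(j - i - 1)%R|%N; lia.
elim: k {ij} => [|k IH]; first exact: alpha_lt.
by rewrite intS [1 + _]addrC addrA; apply: lt_trans IH (alpha_lt _).
Qed.

End Grids.

(** * Homeomorphisms approximating the jump maps *)

Section Stretching.
Variable R : realType.
Implicit Types (alpha : int -> R) (x y d : R) (i p : int).

(** An increasing bijection pulls open intervals back to open intervals; continuity of the glued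
    lifts thus comes from order alone. *)
Lemma homo_can_continuous (f g : R -> R) : cancel f g -> cancel g f ->
  {homo f : x y / x < y} -> continuous f.
Proof.
move=> fK gK inc x; apply/cvgrPdist_lt => e e0.
have mono : {mono f : x y / x < y} by apply: leW_mono; exact: le_mono.
have : x \in `]g (f x - e), g (f x + e)[.
  by rewrite in_itv /=; apply/andP; split; rewrite -mono gK; lra.
move=> /near_in_itvoo; apply: filterS => y.
rewrite in_itv /= => /andP[]; rewrite -[g _ < _]mono gK => ?; rewrite -mono gK => ?.
by rewrite ltr_norml; apply/andP; split; lra.
Qed.

Lemma circle_lift_of_can (f g : R -> R) : cancel f g -> cancel g f ->
  {homo f : x y / x < y} -> (forall x, f (x + 1) = f x + 1) ->
  exists F : circle_lift R, F =1 f.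
Proof.
move=> fK gK inc per.
have mono : {mono f : x y / x < y} by apply: leW_mono; exact: le_mono.
have ginc : {homo g : x y / x < y} by move=> x y xy; rewrite -mono !gK.
by exists (CircleLift fK gK (homo_can_continuous fK gK inc)
  (homo_can_continuous gK fK ginc) inc per).
Qed.

(* A concave piecewise linear bijection onto (alpha (i + p - 1), alpha (i + p)]
   from (alpha (i - 1), alpha i], with slopes [d^-1] and then [d]; the inverse of
   a minimum of increasing bijections is the maximum of their inverses. *)
Definition stretch alpha d p i x : R :=
  Num.min (alpha (i + p - 1) + d^-1 * (x - alpha (i - 1)))
          (alpha (i + p) - d * (alpha i - x)).

Definition unstretch alpha d p i y : R :=
  Num.max (alpha (i - 1) + d * (y - alpha (i + p - 1)))
          (alpha i - d^-1 * (alpha (i + p) - y)).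

Section OneStretch.
Variables (alpha : int -> R) (n : nat) (d : R) (p : int).
Hypotheses (alphaP : grid alpha n) (d0 : 0 < d).
Hypothesis gap : forall i, alpha (i - 1) + d <= alpha i.

Let dV : d * d^-1 = 1. Proof. by rewrite mulfV ?gt_eqF. Qed.
Let dV0 : 0 < d^-1. Proof. by rewrite invr_gt0. Qed.

Let gap1 i : alpha i <= alpha (i - 1) + 1.
Proof.
have [n0 _ _] := alphaP.
have := grid_shift alphaP (i - 1) 1; rewrite -[1%:~R]/1 => <-.
by rewrite (grid_le alphaP); lia.
Qed.

Lemma stretchK i : cancel (stretch alpha d p i) (unstretch alpha d p i).
Proof.
move=> x; rewrite /stretch /unstretch.
set a := alpha (i - 1); set b := alpha i; set a' := alpha (i + p - 1).
set b' := alpha (i + p).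
have e1 : a + d * (a' + d^-1 * (x - a) - a') = x.
  by rewrite addrAC subrr add0r mulrA dV; lra.
have e2 : b - d^-1 * (b' - (b' - d * (b - x))) = x.
  by rewrite subKr mulrA [_ * d]mulrC dV; lra.
have [le|/ltW le] := leP (a' + d^-1 * (x - a)) (b' - d * (b - x)).
  rewrite e1; apply/max_idPl; rewrite -[leRHS]e2 lerD2l lerN2 ler_pM2l //; lra.
rewrite e2; apply/max_idPr; rewrite -[leRHS]e1 lerD2l ler_pM2l //; lra.
Qed.

Lemma unstretchK i : cancel (unstretch alpha d p i) (stretch alpha d p i).
Proof.
move=> x; rewrite /stretch /unstretch.
set a := alpha (i - 1); set b := alpha i; set a' := alpha (i + p - 1).
set b' := alpha (i + p).
have e1 : a' + d^-1 * (a + d * (x - a') - a) = x.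
  by rewrite [a + _]addrC addrK mulrA [_ * d]mulrC dV; lra.
have e2 : b' - d * (b - (b - d^-1 * (b' - x))) = x.
  by rewrite subKr mulrA dV; lra.
have [le|/ltW le] := leP (a + d * (x - a')) (b - d^-1 * (b' - x)).
  rewrite e2; apply/min_idPr; rewrite -[leLHS]e1 lerD2l ler_pM2l //; lra.
rewrite e1; apply/min_idPl; rewrite -{1}e2 lerD2l lerN2 ler_pM2l //; lra.
Qed.

Lemma stretch_inc i : {homo stretch alpha d p i : x y / x < y}.
Proof.
move=> x y xy; rewrite /stretch lt_min !gt_min.
have h1 : d^-1 * x < d^-1 * y by rewrite ltr_pM2l.
have h2 : d * x < d * y by rewrite ltr_pM2l.
by apply/andP; split; apply/orP; [left|right]; rewrite !mulrBr; lra.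
Qed.

(** Over a gap of at least [d], the piece of slope [d^-1] rises by at least 1, hence by at least the
    target gap; so the other piece is the minimum at the right end. *)
Lemma stretch_right i : stretch alpha d p i (alpha i) = alpha (i + p).
Proof.
rewrite /stretch subrr mulr0 subr0; apply/min_idPr.
have h : d * d^-1 <= d^-1 * (alpha i - alpha (i - 1)).
  by rewrite [d * _]mulrC ler_pM2l //; have := gap i; lra.
by have := gap1 (i + p); rewrite dV in h; lra.
Qed.

Lemma stretch_left i : stretch alpha d p i (alpha (i - 1)) = alpha (i + p - 1).
Proof.
rewrite /stretch subrr mulr0 addr0; apply/min_idPl.
have h : d * (alpha i - alpha (i - 1)) <= d * 1.
  by rewrite ler_pM2l //; have := gap1 i; lra.
by have := gap (i + p); lra.
Qed.

Lemma stretch_close i x : alpha (i - 1) + d <= x -> x <= alpha i ->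
  alpha (i + p) - d <= stretch alpha d p i x.
Proof.
move=> lo hi; rewrite /stretch le_min; apply/andP; split.
  have h : d * d^-1 <= d^-1 * (x - alpha (i - 1)) by rewrite [d * _]mulrC ler_pM2l //; lra.
  by have := gap1 (i + p); rewrite dV in h; have := d0; lra.
rewrite lerD2l lerN2 -[leRHS]mulr1 ler_pM2l //.
by have := gap1 i; have := d0; lra.
Qed.

(** The stretches of the successive cells are glued together. The second clause says that [F] is
    within [d] of the jump map, except at points less than [d] to the right of a grid point. *)
Lemma stretched_lift : exists F : circle_lift R,
  (forall i, F (alpha i) = alpha (i + p)) /\
  (forall i x, alpha (i - 1) + d <= x -> x <= alpha i -> alpha (i + p) - d <= F x).
Proof.
have [n0 _ _] := alphaP.
have stretch_mono i : {mono stretch alpha d p i : x y / x <= y}.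
  exact/le_mono/stretch_inc.
have stretch_in i x : alpha (i - 1) < x <= alpha i ->
    alpha (i + p - 1) < stretch alpha d p i x <= alpha (i + p).
  by rewrite -stretch_left -stretch_right stretch_mono (leW_mono (stretch_mono i)).
have unstretch_in i y : alpha (i + p - 1) < y <= alpha (i + p) ->
    alpha (i - 1) < unstretch alpha d p i y <= alpha i.
  rewrite -{1}[y](unstretchK i) -{2}[y](unstretchK i) -stretch_left -stretch_right.
  by rewrite stretch_mono (leW_mono (stretch_mono i)).
pose c := grid_ceil alpha.
pose f x := stretch alpha d p (c x) x.
pose g y := unstretch alpha d p (c y - p) y.
have cP x := grid_ceilP alphaP x.
(* Cell indices move by exactly [p], so the inverse can recover the piece to undo from its
   argument. *)
have cf x : c (f x) = c x + p.
  by have /andP[? ?] := stretch_in _ _ (cP x); exact: (grid_ceil_eq alphaP).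
have cg y : c (g y) = c y - p.
  have := unstretch_in (c y - p) y; rewrite subrK => /(_ (cP y))/andP[? ?].
  exact: (grid_ceil_eq alphaP).
have fK : cancel f g by move=> x; rewrite /g cf addrK stretchK.
have gK : cancel g f by move=> y; rewrite /f cg unstretchK.
have inc : {homo f : x y / x < y}.
  move=> x y xy; have := grid_ceil_mono alphaP (ltW xy).
  rewrite le_eqVlt => /orP[/eqP cxy|cxy]; first by rewrite /f /c -cxy stretch_inc.
  have /andP[_ fx] := stretch_in _ _ (cP x); have /andP[fy _] := stretch_in _ _ (cP y).
  apply: le_lt_trans fx (le_lt_trans _ fy).
  by rewrite (grid_le alphaP); move: cxy; rewrite -/(c x) -/(c y); lia.
have per x : f (x + 1) = f x + 1.
  have sh i j : j = i + n%:Z -> alpha j = alpha i + 1.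
    by move=> ->; rewrite -[n%:Z]mul1r (grid_shift alphaP).
  rewrite /f /stretch /c -[1]/(1%:~R) (grid_ceilD alphaP) mul1r -/c.
  rewrite (sh (c x + p - 1) (c x + n%:Z + p - 1)); last by ring.
  rewrite (sh (c x - 1) (c x + n%:Z - 1)); last by ring.
  rewrite (sh (c x + p) (c x + n%:Z + p)); last by ring.
  rewrite (sh (c x) (c x + n%:Z)); last by ring.
  by rewrite -[1%:~R]/1 addr_minl; congr Num.min; ring.
have [F Ff] := circle_lift_of_can fK gK inc per.
exists F; split=> [i|i x lo hi]; rewrite Ff /f /c.
  by rewrite (grid_ceil_grid alphaP) stretch_right.
have -> : grid_ceil alpha x = i by apply: (grid_ceil_eq alphaP) => //; have := d0; lra.
exact: stretch_close.
Qed.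

End OneStretch.
End Stretching.

(** * Positive words in jump maps and their periodic orbits *)

Section Words.
Variable R : realType.
Implicit Types (alpha beta : int -> R) (x y d : R) (i j m : int) (u : seq letter).

Lemma grid_next_gap beta n x : grid beta n ->
  exists2 d, 0 < d & forall j, x < beta j -> x + 2 * d <= beta j.
Proof.
move=> bP; pose c := grid_ceil beta x.
have [j0 xj0 j0min] : exists2 j0, x < beta j0 & forall j, x < beta j -> j0 <= j.
  have [xc|xc] := ltP x (beta c).
    exists c => // j /ltW; exact: grid_ceil_le bP _ _.
  exists (c + 1).
    by apply: le_lt_trans (grid_ceil_ge bP x) _; rewrite (grid_lt bP); lia.
  by move=> j /(le_lt_trans xc); rewrite (grid_lt bP); lia.
exists ((beta j0 - x) / 2); first by rewrite divr_gt0 ?subr_gt0.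
by move=> j /j0min; rewrite -(grid_le bP) mulrC divfK ?pnatr_eq0 //; lra.
Qed.

(** Periodicity leaves only [n] values of [i] to treat, each with a positive gap to the next point
    of [beta]. *)
Lemma grid_pair_gap alpha beta n n' : grid alpha n -> grid beta n' ->
  exists2 d, 0 < d & forall i j, alpha i < beta j -> alpha i + 2 * d <= beta j.
Proof.
move=> aP bP; have [n0 _ _] := aP.
have [d d0 dP] : exists2 d, 0 < d &
    forall (k : nat) j, (k < n)%N -> alpha k%:Z < beta j -> alpha k%:Z + 2 * d <= beta j.
  elim: n {aP n0} => [|k [d d0 dP]]; first by exists 1.
  have [e e0 eP] := grid_next_gap (alpha k%:Z) bP.
  exists (Num.min d e); first by rewrite lt_min d0.
  have minl : Num.min d e <= d by rewrite ge_min lexx.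
  have minr : Num.min d e <= e by rewrite ge_min lexx orbT.
  move=> l j; rewrite ltnS leq_eqVlt => /orP[/eqP ->|lk] lt_lj.
    by have := eP _ lt_lj; lra.
  by have := dP _ _ lk lt_lj; lra.
exists d => // i j.
have nz : n%:Z != 0 by rewrite eqz_nat -lt0n.
pose m := (i %/ n%:Z)%Z; pose k := `|(i %% n%:Z)%Z|%N.
have kn : (k < n)%N.
  by rewrite -ltz_nat /k gez0_abs ?modz_ge0 // ltz_pmod.
have -> : i = k%:Z + m * n%:Z by rewrite /k gez0_abs ?modz_ge0 // addrC -divz_eq.
have -> : j = (j - m * n'%:Z) + m * n'%:Z by rewrite subrK.
rewrite (grid_shift aP) (grid_shift bP) ltrD2r => /(dP _ _ kn); lra.
Qed.

(** The factor 2 keeps a point lying [d] to the left of one grid point at least [d] to the right of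
    every earlier one, as [stretched_lift] demands. *)
Lemma grid_common_gap (alpha : bool -> int -> R) (n : bool -> nat) :
  (forall b, grid (alpha b) (n b)) ->
  exists2 d, 0 < d & forall b b' i j,
    alpha b i < alpha b' j -> alpha b i + 2 * d <= alpha b' j.
Proof.
move=> aP.
have /choice[d dP] (bb : bool * bool) : exists d, 0 < d /\
    forall i j, alpha bb.1 i < alpha bb.2 j -> alpha bb.1 i + 2 * d <= alpha bb.2 j.
  by have [d] := grid_pair_gap (aP bb.1) (aP bb.2); exists d.
exists (\big[Num.min/1]_bb d bb).
  apply: (big_ind (fun z => 0 < z)) => // [x y x0 y0|bb _].
    by rewrite lt_min x0.
  by case: (dP bb).
move=> b b' i j /(proj2 (dP (b, b'))) /=.
by have := bigmin_le_cond 1 d (isT : xpredT (b, b')); rewrite /=; lra.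
Qed.

(** Letters act by arbitrary functions because jump maps are not homeomorphisms. Signs are ignored,
    so this is meant for positive words; the head letter acts last. *)
Definition word_fun (h : bool -> R -> R) u x : R := foldr (fun l => h l.1) x u.

Lemma word_fun_le (h k : bool -> R -> R) u x y :
  (forall b x, h b x <= k b x) ->
  (forall b x y, x <= y -> k b x <= k b y) ->
  x <= y -> word_fun h u x <= word_fun k u y.
Proof.
move=> hk kle xy; elim: u => //= l u IH.
exact: le_trans (hk _ _) (kle _ _ _ IH).
Qed.

Lemma iter_word_fun_le (h k : bool -> R -> R) u (N : nat) x y :
  (forall b x, h b x <= k b x) ->
  (forall b x y, x <= y -> k b x <= k b y) ->
  x <= y -> iter N (word_fun h u) x <= iter N (word_fun k u) y.
Proof. by move=> hk kle xy; elim: N => //= N IH; exact: word_fun_le. Qed.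

(** Pigeonhole: among the indices visited at times 0 to [n], two agree modulo [n], and the
    corresponding grid points differ by an integer. *)
Lemma grid_valued_period alpha n (W : R -> R) : grid alpha n ->
  (forall x, exists i, W x = alpha i) ->
  exists i m (k : nat), (0 < k <= n)%N /\ iter k W (alpha i) = alpha i + m%:~R.
Proof.
move=> aP WP; have [n0 _ _] := aP.
have /choice[sg sgP] i : exists j, W (alpha i) = alpha j by exact: WP.
have nz : n%:Z != 0 by rewrite eqz_nat -lt0n.
have itW k i : iter k W (alpha i) = alpha (iter k sg i).
  by elim: k => //= k ->.
pose o k := iter k sg 0.
have rn k : (`|(o k %% n%:Z)%Z|%N < n)%N.
  by rewrite -ltz_nat gez0_abs ?modz_ge0 // ltz_pmod.
pose r (k : 'I_n.+1) : 'I_n := Ordinal (rn k).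
have /injectivePn[k [l kl rkl]] : ~~ injectiveb r.
  by apply/injectiveP => /leq_card; rewrite !card_ord ltnn.
wlog lt_kl : k l kl rkl / (k < l)%N.
  by move=> H; have [lt|lt|/val_inj eq] := ltngtP k l;
    [exact: (H k l)|apply: (H l k); rewrite 1?eq_sym|rewrite eq eqxx in kl].
have [m om] : exists m, o l = o k + m * n%:Z.
  exists ((o l %/ n%:Z)%Z - (o k %/ n%:Z)%Z).
  have : (o k %% n%:Z)%Z = (o l %% n%:Z)%Z.
    by have /(congr1 (fun z => (val z)%:Z)) /= := rkl; rewrite !gez0_abs ?modz_ge0.
  by have := divz_eq (o l) n%:Z; have := divz_eq (o k) n%:Z; nia.
exists (o k), m, (l - k)%N; split; first by have := ltn_ord l; lia.
by rewrite itW /o -iterD subnK ?(ltnW lt_kl) // -/(o l) om (grid_shift aP).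
Qed.

(* [F] sends the point at distance [d] to the left of any grid point to a point at
   distance at most [d] to the left of its image under the jump map, so periodic
   orbits of the jump maps survive for [F]. *)
Lemma word_rot_dominated (G : bool -> circle_lift R) (p : bool -> int)
    (n : bool -> nat) (l : letter) u :
  (forall b, (0 < n b)%N) -> (forall b, coprimez (p b) (n b)%:Z) ->
  (forall b, rot_num (G b) = (p b)%:~R / (n b)%:R) ->
  exists (F : bool -> circle_lift R) m (k : nat),
    [/\ forall b, rot_num (F b) = (p b)%:~R / (n b)%:R, (0 < k <= n l.1)%N &
        forall g f : circle_lift R,
          g =1 word_fun G (l :: u) -> f =1 word_fun F (l :: u) ->
          rot_num g <= m%:~R / k%:R /\ rot_num f = m%:~R / k%:R].
Proof.
move=> n0 cop rotG.
have /choice[alpha alphaP] b := rational_rot_grid (n0 b) (cop b) (rotG b).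
have aP b : grid (alpha b) (n b) by case: (alphaP b).
have Ga b : forall i, G b (alpha b i) = alpha b (i + p b) by case: (alphaP b).
have [d d0 gap] := grid_common_gap aP.
have gap1 b i : alpha b (i - 1) + 2 * d <= alpha b i.
  by apply: gap; rewrite (grid_lt (aP b)); lia.
have /choice[F FP] b : exists F : circle_lift R,
    (forall i, F (alpha b i) = alpha b (i + p b)) /\
    (forall i x, alpha b (i - 1) + d <= x -> x <= alpha b i ->
       alpha b (i + p b) - d <= F x).
  by apply: (stretched_lift _ (aP b) d0) => i; have := gap1 b i; lra.
have Fa b : forall i, F b (alpha b i) = alpha b (i + p b) by case: (FP b).
pose J b := grid_jump (alpha b) (p b).
have Jle b x y : x <= y -> J b x <= J b y by exact: grid_jump_mono (aP b) _ _ _.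
pose W := word_fun J (l :: u).
(* The letter [l] acts last, so values lie in its grid; this is what bounds the period by
   [n l.1]. *)
have WP x : exists i, W x = alpha l.1 i.
  by exists (grid_ceil (alpha l.1) (word_fun J u x) + p l.1).
have [i [m [k [k0 Wk]]]] := grid_valued_period (aP l.1) WP.
(* Intermediate values stay on the union of the two grids, where [gap] applies. *)
pose E x := exists b i, x = alpha b i.
have close v x : E x -> E (word_fun J v x) /\
    word_fun J v x - d <= word_fun F v (x - d).
  move=> Ex; elim: v => [|l' v [Ey IH]] /=; first by split.
  split; first by exists l'.1; eexists.
  set y := word_fun J v x in Ey IH *; set b := l'.1.
  have [b' [j yj]] := Ey.
  have [lo hi] := andP (grid_ceilP (aP b) y).
  have Fy : J b y - d <= F b (y - d).
    have [_ H] := FP b; apply: (H (grid_ceil (alpha b) y)); last by lra.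
    have := lo; rewrite [X in _ < X]yj => /gap; rewrite -yj => ?; lra.
  by apply: le_trans Fy _; exact: (@iter_le _ (F b) 1).
(* Stated for any lifts translating both grids, since it serves for [G] and again for [F]. *)
have upper (H : bool -> circle_lift R) (h : circle_lift R) : h =1 word_fun H (l :: u) ->
    (forall b i, H b (alpha b i) = alpha b (i + p b)) -> rot_num h <= m%:~R / k%:R.
  move=> hE Ha; have /andP[k1 _] := k0.
  apply: (@rot_le_period _ h (alpha l.1 i)) => //; rewrite -Wk (eq_iter hE).
  by apply: iter_word_fun_le => // b x; exact: le_grid_jump (aP b) _ _ _ (Ha b).
exists F, m, k; split=> // [b|g f gE fE].
  by apply: grid_rot (aP b) _ _ _.
split; first by apply: upper gE Ga.
apply/eqP; rewrite eq_le (upper F f) //=.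
have /andP[k1 _] := k0.
apply: (@rot_ge_period _ f (alpha l.1 i - d)) => //.
rewrite (eq_iter fE) addrAC -Wk.
have : E (alpha l.1 i) by exists l.1, i.
move: (alpha l.1 i) => x Ex.
have : E (iter k W x) /\ iter k W x - d <= iter k (word_fun F (l :: u)) (x - d).
  elim: (k) => [|K [EK IH]]; first by split.
  rewrite !iterS; have [EW cl] := close (l :: u) _ EK; split=> //.
  apply: le_trans cl _; apply: word_fun_le => // b y z.
  exact: (@iter_le _ (F b) 1).
by case.
Qed.

End Words.

(** * Positive words in the free group and its universal property *)

Section FreeGroup.
Implicit Types (u v : seq letter) (w : free2) (b : bool).

Definition gen b : free2 := @Free2 [:: (b, true)] isT.

Definition positive_seq u : bool := all (fun l : letter => l.2) u.

Lemma positive_reduced u : positive_seq u -> reduced u.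
Proof.
elim: u => // -[g e] [//|[g' e'] u] IH /andP[/= le pu].
apply/andP; split; last exact: IH.
by move: le pu => -> /andP[/= -> _]; apply/eqP => -[].
Qed.

Lemma lmul_positive (l : letter) u : positive_seq (l :: u) -> lmul l u = l :: u.
Proof.
case: u l => // -[g' e'] u [g e] /and3P[/= -> -> _].
by case: eqP => // -[].
Qed.

Lemma red_mul_positive u v : positive_seq (u ++ v) -> red_mul u v = u ++ v.
Proof.
elim: u => //= l u IH puv; rewrite IH; first exact: lmul_positive.
by case/andP: puv.
Qed.

Section UniversalProperty.
Variables (H : groupType) (G : bool -> H).

Definition letter_eval (l : letter) : H := if l.2 then G l.1 else (G l.1)^-1%g.

Definition free2_eval w : H := foldr (fun l h => (letter_eval l * h)%g) 1%g w.

Lemma letter_eval_inv l : letter_eval (letter_inv l) = (letter_eval l)^-1%g.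
Proof. by case: l => g [] //=; rewrite /letter_eval /= invgK. Qed.

(** A letter put in front of a reduced word either stays or cancels the head, and in that case the
    two values are mutually inverse. *)
Lemma free2_evalM : {morph free2_eval : w w' / (w * w')%g}.
Proof.
move=> w w'; rewrite /free2_eval.
have -> : free2_word (w * w')%g = red_mul w w' by [].
elim: (free2_word w) => [|l u IH] /=; first by rewrite mul1g.
rewrite -mulgA -{}IH; case: (red_mul u w') => //= y t.
by case: eqP => // ->; rewrite letter_eval_inv mulVKg.
Qed.

HB.instance Definition _ := isMultiplicative.Build free2 H free2_eval free2_evalM.

Definition free2_hom : {multiplicative free2 -> H} := free2_eval.

Lemma free2_hom_gen b : free2_hom (gen b) = G b.
Proof. exact: mulg1. Qed.

End UniversalProperty.

Lemma gmulf1_group (H : groupType) (rho : {multiplicative free2 -> H}) :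
  rho 1%g = 1%g.
Proof. by apply: (mulgI (rho 1%g)); rewrite -gmulfM !mulg1. Qed.

Lemma free2_cons (l : letter) w w' : w = l :: w' :> seq letter ->
  positive_word w -> w = (gen l.1 * w')%g.
Proof.
rewrite /positive_word => wE; rewrite wE => pw; apply: val_inj.
have lE : (l.1, true) = l by case/andP: pw; case: (l) => g e /= ->.
by rewrite /= lE lmul_positive.
Qed.

Lemma positive_word_power b w : positive_word w ->
  all (fun l : letter => l.1 == b) w -> is_power_of (gen b) w.
Proof.
case: w => u ru; rewrite /positive_word /= => pu ub.
exists (size u); left; elim: u ru pu ub => [|l u IH] ru pu ub.
  exact: val_inj.
have ru' := reduced_cons ru.
have [/eqP lb ub'] := andP ub; have [_ pu'] := andP pu.
rewrite /= expgS -(IH ru') // -lb.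
exact: (@free2_cons l (Free2 ru) (Free2 ru')).
Qed.

Lemma free2_eval_word_fun (R : realType)
    (rho : {multiplicative free2 -> circle_lift R}) w : positive_word w ->
  rho w =1 word_fun (fun b => rho (gen b)) w.
Proof.
case: w => u ru; rewrite /positive_word /= => pu x.
elim: u ru pu => [|l u IH] ru pu.
  have -> : Free2 ru = 1%g by exact: val_inj.
  by rewrite gmulf1_group.
have [_ pu'] := andP pu; have ru' := reduced_cons ru.
rewrite (@free2_cons l (Free2 ru) (Free2 ru')) // gmulfM /=.
by rewrite (IH ru').
Qed.

End FreeGroup.

(** * The supremum as an attained rational maximum *)

Section RotationSupremum.
Variable R : realType.
Implicit Types (rho : {multiplicative free2 -> circle_lift R}) (w : free2).

(** Translations provide a representation for any prescribed [r] and [s], so the supremum is never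
    over an empty set. *)
Lemma rot_translation (t : R) : exists F : circle_lift R, rot_num F = t.
Proof.
have [|||x|F Ff] := @circle_lift_of_can R (fun x => x + t) (fun x => x - t).
- by move=> x; rewrite addrK.
- by move=> x; rewrite subrK.
- by move=> x y xy; rewrite ltrD2r.
- by rewrite addrAC.
have ge : t / 1%:R <= rot_num F by apply: rot_ge_unif => // x; rewrite /= Ff.
have le : rot_num F <= t / 1%:R by apply: rot_le_unif => // x; rewrite /= Ff.
by exists F; apply/eqP; rewrite eq_le; move: ge le; rewrite divr1 => -> ->.
Qed.

(** The bound depends on [p] alone, hence is uniform over all lifts with this rotation number; this
    keeps the supremum finite. *)
Lemma rational_rot_displacement (f : circle_lift R) (p : int) (n : nat) x :
  (0 < n)%N -> coprimez p n%:Z -> rot_num f = p%:~R / n%:R ->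
  f x <= x + (`|p| + 1)%:~R.
Proof.
move=> n0 cop /(rational_rot_grid n0 cop)[alpha [aP fa]].
exact: le_trans (le_grid_jump aP _ fa) (grid_jump_bound aP _ _).
Qed.

Lemma word_fun_displacement (h : bool -> R -> R) (K : R) (u : seq letter) x :
  (forall b x, h b x <= x + K) -> word_fun h u x <= x + (size u)%:R * K.
Proof.
move=> hK; elim: u => [|l u IH] /=; first by rewrite mul0r addr0.
by apply: le_trans (hK _ _) _; rewrite -natr1; lra.
Qed.

Lemma bounded_int_max (Q : int -> Prop) (B : int) : (exists m, Q m) ->
  (forall m, Q m -> m <= B) -> exists2 m, Q m & forall m', Q m' -> m' <= m.
Proof.
move=> [m0 Qm0] QB.
have ex : exists k : nat, `[< Q (B - k%:Z) >].
  exists `|(B - m0)%R|%N; apply/asboolP.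
  by rewrite gez0_abs ?subr_ge0 ?QB // subKr.
case: (ex_minnP ex) => k /asboolP Qk kmin; exists (B - k%:Z) => // m Qm.
have := QB _ Qm => mB.
have := kmin `|(B - m)%R|%N; rewrite gez0_abs ?subr_ge0 // subKr.
move=> le_k; have : (k <= `|(B - m)%R|)%N by apply: le_k; exact/asboolP.
lia.
Qed.

Lemma denq_frac_le (m : int) (k : nat) : (0 < k)%N ->
  denq (m%:~R / k%:R) <= k%:Z.
Proof.
move=> k0; set q : rat := m%:~R / k%:R.
have E : numq q * k%:Z = m * denq q.
  apply: (@intr_inj rat); rewrite !intrM.
  have : q * k%:R = m%:~R by rewrite divfK // pnatr_eq0 -lt0n.
  rewrite -{1}(divq_num_den q) => <-.
  by rewrite mulrAC divfK // intr_eq0 denq_neq0.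
have : (denq q %| k%:Z)%Z.
  rewrite -(@Gauss_dvdzr _ (numq q)).
    by rewrite E dvdz_mull.
  by rewrite coprimez_sym coprimezE coprime_num_den.
by move=> /(dvdn_leq k0); rewrite -lez_nat absz_denq.
Qed.

Definition rot_rep (r s : R) rho : Prop :=
  rot_num (rho gen_a) = r /\ rot_num (rho gen_b) = s.

Lemma rot_rep_exists (r s : R) : exists rho, rot_rep r s rho.
Proof.
have [Fr rotr] := rot_translation r; have [Fs rots] := rot_translation s.
exists (free2_hom (fun b => if b then Fs else Fr)).
split; rewrite -?[gen_a]/(gen false) -?[gen_b]/(gen true) free2_hom_gen //.
Qed.

(** For each [rho], the images of the two products are conjugate by [rho w']. *)
Lemma rot_sup_mulC (w w' : free2) (r s : R) :
  rot_sup (w * w')%g r s = rot_sup (w' * w)%g r s.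
Proof.
rewrite /rot_sup; congr (ereal_sup _); apply: eq_imagel => rho _.
by congr (_%:E); apply: (@rot_conj _ _ _ (rho w')) => x; rewrite !gmulfM.
Qed.

Lemma rot_sup_nil (r s : R) : rot_sup 1%g r s = 0%E.
Proof.
have rot1 : rot_num (1%g : circle_lift R) = 0.
  by rewrite (@rot_period _ _ 0 0 1) ?mul0r // addr0.
apply/eqP; rewrite eq_le; apply/andP; split.
  by apply: ge_ereal_sup => _ [rho _ <-]; rewrite gmulf1_group rot1.
apply: ereal_sup_ubound.
have [rho rhoP] := rot_rep_exists r s.
by exists rho => //; rewrite gmulf1_group rot1.
Qed.

(** Every realised value is dominated by a realised fraction whose denominator is at most that of
    the leading letter. Multiplied by a factorial, these fractions become integers bounded above, so
    a largest one exists. *)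
Lemma rot_sup_head (w : free2) (l : letter) (u : seq letter) (r s : rat) :
  w = l :: u :> seq letter -> positive_word w ->
  exists q : rat, rot_sup w (ratr r : R) (ratr s) = (ratr q)%:E /\
    denq q <= denq (if l.1 then s else r).
Proof.
move=> wE pw.
pose t (b : bool) := if b then s else r.
pose p b := numq (t b); pose n b := `|denq (t b)|%N.
have n0 b : (0 < n b)%N by rewrite absz_gt0 denq_neq0.
have nE b : (n b)%:Z = denq (t b) by rewrite absz_denq.
have cop b : coprimez (p b) (n b)%:Z by rewrite coprimezE coprime_num_den.
have tE b : ratr (t b) = (p b)%:~R / (n b)%:R :> R.
  by rewrite -[in LHS](divq_num_den (t b)) fmorph_div /= !ratr_int -nE.
pose V x := exists2 rho, rot_rep (ratr r) (ratr s) rho & rot_num (rho w) = x.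
have gens rho : rot_rep (ratr r) (ratr s) rho <->
    forall b, rot_num (rho (gen b)) = (p b)%:~R / (n b)%:R.
  split=> [[ra rb] b|H]; first by rewrite -tE; case: b.
  by split; [rewrite (H false) -tE|rewrite (H true) -tE].
have dominated x : V x -> exists (m : int) (k : nat),
    [/\ (0 < k <= n l.1)%N, x <= m%:~R / k%:R & V (m%:~R / k%:R)].
  move=> [rho /gens rotG <-].
  have [F [m [k [rotF kn H]]]] := word_rot_dominated l u n0 cop rotG.
  exists m, k; have [||le eq] := H (rho w) (free2_hom F w).
  - by rewrite -wE; exact: free2_eval_word_fun.
  - by move=> x1; rewrite -wE free2_eval_word_fun //; congr (word_fun _ _ _).
  split=> //; exists (free2_hom F) => //.
  by apply/gens => b; rewrite free2_hom_gen.
have [B VB] : exists B : R, forall x, V x -> x <= B.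
  pose K : R := (`|p false| + `|p true| + 1)%:~R.
  exists ((size w)%:R * K) => _ [rho /gens rotG <-].
  rewrite -[leRHS]divr1; apply: (@rot_le_unif _ _ _ 1) => // x /=.
  rewrite free2_eval_word_fun //; apply: word_fun_displacement => b y.
  apply: le_trans (rational_rot_displacement y (n0 b) (cop b) (rotG b)) _.
  by rewrite lerD2l ler_int; case: b {rotG}; lia.
have [x0 Vx0] : exists x, V x.
  have [rho rhoP] := rot_rep_exists (ratr r) (ratr s).
  by exists (rot_num (rho w)), rho.
(* candidate maxima, over a common denominator *)
pose N := (n l.1)`!.
have N0 : 0 < N%:R :> R by rewrite ltr0n fact_gt0.
pose Q (M : int) := exists (m : int) (k : nat),
  [/\ (0 < k <= n l.1)%N, M%:~R = m%:~R / k%:R * N%:R :> R & V (m%:~R / k%:R)].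
have dominatedQ x : V x -> exists2 M, Q M & x * N%:R <= M%:~R.
  move=> /dominated[m [k [kn xk Vk]]]; have /andP[k0 _] := kn.
  have E : (m * (N %/ k)%:Z)%:~R = m%:~R / k%:R * N%:R :> R.
    have /divnK : (k %| N)%N by rewrite dvdn_fact.
    move=> /(congr1 (fun j : nat => j%:R : R)); rewrite natrM => <-.
    by rewrite mulrA mulrAC divfK ?pnatr_eq0 -?lt0n // intrM.
  exists (m * (N %/ k)%:Z); first by exists m, k.
  by rewrite E ler_pM2r.
have [|M|M [m [k [kn ME Vk]]] Mmax] := @bounded_int_max Q (Num.floor (B * N%:R)).
- by have [M QM _] := dominatedQ _ Vx0; exists M.
- by move=> [m [k [_ ME /VB]]]; rewrite -(ler_pM2r N0) -ME floor_ge_int.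
have /andP[k0 kle] := kn.
have qE : ratr (m%:~R / k%:R) = m%:~R / k%:R :> R.
  by rewrite fmorph_div /= ratr_int ratr_nat.
exists (m%:~R / k%:R); split; last first.
  by apply: le_trans (denq_frac_le m k0) _; rewrite -/(t l.1) -nE lez_nat.
rewrite qE; apply/eqP; rewrite eq_le; apply/andP; split.
  apply: ge_ereal_sup => _ [rho rhoP <-]; rewrite lee_fin -(ler_pM2r N0) -ME.
  have [|M' /Mmax QM' le] := dominatedQ (rot_num (rho w)); first by exists rho.
  by apply: le_trans le _; rewrite ler_int.
by apply: ereal_sup_ubound; have [rho rhoP <-] := Vk; exists rho.
Qed.

End RotationSupremum.

Theorem mainTheorem1 (R : realType) (w : free2) (r s : rat)
  (hw : positive_word w) :
  exists q : rat,
    rot_sup w (ratr r : R) (ratr s : R) = ((ratr q : R)%:E)%E /\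
    (~ is_power_of gen_a w -> ~ is_power_of gen_b w ->
     denq q <= Num.min (denq r) (denq s)).
Proof.
case wE : (free2_word w) => [|l u].
  (* The empty word has no leading letter; its supremum 0 has denominator 1. *)
  have -> : w = 1%g by exact: val_inj.
  exists 0; rewrite rot_sup_nil rmorph0; split=> // _ _.
  by rewrite le_min -!gtz0_ge1 !denq_gt0.
have [q [qE dq]] := rot_sup_head R r s wE hw.
exists q; split=> // na nb.
(* If every letter used the generator of [l], then [w] would be a power of it. *)
have /hasP[l' l'w l'l] : has (fun l' : letter => l'.1 != l.1) w.
  rewrite has_predC; apply/negP => /(positive_word_power hw).
  by case: (l.1).
have [u1 [u2 uE]] : exists u1 u2, free2_word w = u1 ++ l' :: u2.
  by case/splitPr: l'w => u1 u2; exists u1, u2.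
move: hw; rewrite /positive_word uE all_cat => /andP[p1 p2].
pose w1 := Free2 (positive_reduced p1); pose w2 := Free2 (positive_reduced p2).
have wM : w = (w1 * w2)%g.
  by apply: val_inj; rewrite /= red_mul_positive // /positive_seq all_cat p1.
have p21 : positive_seq ((l' :: u2) ++ u1) by rewrite /positive_seq all_cat p1 p2.
have w'E : free2_word (w2 * w1)%g = l' :: (u2 ++ u1) by exact: red_mul_positive.
have [|q' [q'E dq']] := rot_sup_head R r s w'E; first by rewrite /positive_word w'E.
(* The rotated word, now led by [l'], has the same supremum, so [q] inherits the bound from the
   other generator as well. *)
have qq' : q' = q.
  by move: q'E; rewrite -rot_sup_mulC -wM qE => -[/fmorph_inj].
rewrite qq' in dq'; rewrite le_min.
by case: (l) (l') l'l dq dq' => [[] ?] [[] ?] //= _ -> ->.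
Qed.
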